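(* Consider the 1D special relativistic hydrodynamics (RHD) system with a Synge-type equation of state $h=h(\theta)=1+e(\theta)+\theta$, $\theta=p/\rho$, satisfying $e'(\theta)>0$ and $h(\theta)>\theta(1+e'(\theta))/e'(\theta)$ for all $\theta>0$. Let $$\mathbf R:=\begin{pmatrix}1&1&1\\ (v_1-c_s)h\gamma&\bigl(h-\theta(1+e'(\theta))\bigr)\gamma v_1&(v_1+c_s)h\gamma\\ (1-v_1c_s)h\gamma&\bigl(h-\theta(1+e'(\theta))\bigr)\gamma&(1+v_1c_s)h\gamma\end{pmatrix}\begin{pmatrix}\sqrt{d_1}&0&0\\0&\sqrt{d_2}&0\\0&0&\sqrt{d_3}\end{pmatrix},$$ where $$d_1=\left(\frac{\rho e'(\theta)}{2(1+e'(\theta))}-\frac{\rho\theta v_1}{2c_sh}\right)\gamma,\qquad d_2=\frac{\rho\gamma}{1+e'(\theta)},\qquad d_3=\left(\frac{\rho e'(\theta)}{2(1+e'(\theta))}+\frac{\rho\theta v_1}{2c_sh}\right)\gamma .$$ Then $$\frac{\partial\mathbf F_1}{\partial\mathbf U}=\mathbf R\boldsymbol\Lambda\mathbf R^{-1},\qquad \frac{\partial\mathbf U}{\partial\mathbf W}=\mathbf R\mathbf R^\top,$$ with $\boldsymbol\Lambda=\mathrm{diag}\left\{\frac{v_1-c_s}{1-v_1c_s},\ v_1,\ \frac{v_1+c_s}{1+v_1c_s}\right\}$.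
   Context: The 1D RHD system is $\partial_t\mathbf U+\partial_{x_1}\mathbf F_1(\mathbf U)=\mathbf 0$ with $\mathbf U=(D,m_1,E)^\top$, $\mathbf F_1=(Dv_1,\ v_1m_1+p,\ m_1)^\top$, $D=\rho\gamma$, $m_1=\rho h\gamma^2v_1$, $E=\rho h\gamma^2-p$, where $\rho>0$, $p>0$, $|v_1|<1$, $\gamma=(1-v_1^2)^{-1/2}$, $\theta=p/\rho$; $e$ is continuously differentiable on $(0,\infty)$. The sound speed $c_s\in(0,1)$ is given by $c_s^2=\frac{\theta(1+e'(\theta))}{h\,e'(\theta)}$. With $S=-\ln\rho+\int^\theta\frac{e'(x)}{x}dx$ (a fixed antiderivative of $e'(\theta)/\theta$), the entropy variables (gradient with respect to $\mathbf U$ of the entropy $\eta=-DS$) are $\mathbf W=\frac1\theta(h-\theta S,\ \gamma v_1,\ -\gamma)^\top$. Derivatives with respect to $\mathbf U$ and $\mathbf W$ are understood through the changes of variables $\mathbf V\leftrightarrow\mathbf U$ and $\mathbf V\leftrightarrow\mathbf W$, $\mathbf V=(\rho,v_1,p)^\top$: $\frac{\partial\mathbf F_1}{\partial\mathbf U}=\frac{\partial\mathbf F_1}{\partial\mathbf V}\left(\frac{\partial\mathbf U}{\partial\mathbf V}\right)^{-1}$ and $\frac{\partial\mathbf U}{\partial\mathbf W}=\frac{\partial\mathbf U}{\partial\mathbf V}\left(\frac{\partial\mathbf W}{\partial\mathbf V}\right)^{-1}$. *)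

(* Defs.v *)
From HB Require Import structures.
From mathcomp Require Import all_boot all_order all_algebra.
From mathcomp Require Import all_classical all_reals all_analysis.
Set Implicit Arguments.
Unset Strict Implicit.
Unset Printing Implicit Defensive.
Import Order.TTheory GRing.Theory Num.Theory.
Import numFieldNormedType.Exports.
Local Open Scope ring_scope.

Definition vec3 (R : realType) (a b c : R) : 'rV[R]_3 :=
  \row_(j < 3) [:: a; b; c]`_j.

Definition mat3 (R : realType) (r1 r2 r3 : 'rV[R]_3) : 'M[R]_3 :=
  \matrix_(i < 3) [:: r1; r2; r3]`_i.

(* States are row vectors, as the library's [jacobian] requires. That operator
   satisfies 'd f V v = v *m jacobian f V, so its transpose is the usual matrix
   whose (i, j) entry is the partial derivative of f_i in the j-th variable. *)
Definition Dmx (R : realType) (f : 'rV[R]_3 -> 'rV[R]_3) (V : 'rV[R]_3) :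
  'M[R]_3 := (jacobian f V)^T.

(* Primitive variables V = (rho, v1, p). *)
Section RHD.
Variables (R : realType) (e : R -> R).

Definition rho_of (V : 'rV[R]_3) : R := V 0 0.
Definition vel (V : 'rV[R]_3) : R := V 0 1.
Definition pres (V : 'rV[R]_3) : R := V 0 2.

Definition enthalpy (theta : R) : R := 1 + e theta + theta.

Definition lorentz (v : R) : R := (Num.sqrt (1 - v ^+ 2))^-1.

Definition theta_of (V : 'rV[R]_3) : R := pres V / rho_of V.

Definition consU (V : 'rV[R]_3) : 'rV[R]_3 :=
  let rho := rho_of V in let v1 := vel V in let p := pres V in
  let h := enthalpy (theta_of V) in let g := lorentz v1 in
  vec3 (rho * g) (rho * h * g ^+ 2 * v1) (rho * h * g ^+ 2 - p).

Definition fluxF1 (V : 'rV[R]_3) : 'rV[R]_3 :=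
  let v1 := vel V in let p := pres V in
  let D := consU V 0 0 in let m1 := consU V 0 1 in
  vec3 (D * v1) (v1 * m1 + p) m1.

(* [s] stands for the chosen antiderivative of x |-> e'(x) / x. *)
Definition entropyS (s : R -> R) (V : 'rV[R]_3) : R :=
  - ln (rho_of V) + s (theta_of V).

Definition entropyW (s : R -> R) (V : 'rV[R]_3) : 'rV[R]_3 :=
  let v1 := vel V in let theta := theta_of V in
  let h := enthalpy theta in let g := lorentz v1 in
  theta^-1 *: vec3 (h - theta * entropyS s V) (g * v1) (- g).

Definition dF1dU (V : 'rV[R]_3) : 'M[R]_3 :=
  Dmx fluxF1 V *m invmx (Dmx consU V).

Definition dUdW (s : R -> R) (V : 'rV[R]_3) : 'M[R]_3 :=
  Dmx consU V *m invmx (Dmx (entropyW s) V).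

Definition sound_speed (theta : R) : R :=
  Num.sqrt (theta * (1 + e^`()%classic theta) /
            (enthalpy theta * e^`()%classic theta)).

Definition Rmx (V : 'rV[R]_3) : 'M[R]_3 :=
  let rho := rho_of V in let v1 := vel V in let theta := theta_of V in
  let h := enthalpy theta in let g := lorentz v1 in
  let cs := sound_speed theta in let e' := e^`()%classic theta in
  let d1 := (rho * e' / (2 * (1 + e')) - rho * theta * v1 / (2 * cs * h)) * g in
  let d2 := rho * g / (1 + e') in
  let d3 := (rho * e' / (2 * (1 + e')) + rho * theta * v1 / (2 * cs * h)) * g in
  mat3
    (vec3 1 1 1)
    (vec3 ((v1 - cs) * h * g)
          ((h - theta * (1 + e')) * g * v1)
          ((v1 + cs) * h * g))
    (vec3 ((1 - v1 * cs) * h * g)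
          ((h - theta * (1 + e')) * g)
          ((1 + v1 * cs) * h * g))
  *m diag_mx (vec3 (Num.sqrt d1) (Num.sqrt d2) (Num.sqrt d3)).

Definition Lambdamx (V : 'rV[R]_3) : 'M[R]_3 :=
  let v1 := vel V in let cs := sound_speed (theta_of V) in
  diag_mx (vec3 ((v1 - cs) / (1 - v1 * cs)) v1 ((v1 + cs) / (1 + v1 * cs))).

End RHD.

(* Main.v *)
Require Import Defs.
From HB Require Import structures.
From mathcomp Require Import all_boot all_order all_algebra.
From mathcomp Require Import all_classical all_reals all_analysis.
From mathcomp Require Import ring lra.
Set Implicit Arguments.
Unset Strict Implicit.
Unset Printing Implicit Defensive.
Import Order.TTheory GRing.Theory Num.Theory.
Import numFieldNormedType.Exports.
Local Open Scope ring_scope.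

(** The factorisation reduces to three matrix identities in the primitive
    variables V = (rho, v1, p).  Write T for the first factor of the matrix R
    (before the square roots) and d for the three weights.  Small waves of the
    primitive equations are easy to describe: the contact wave moves rho alone,
    and an acoustic wave keeps the entropy constant, so that dp = h c_s^2 drho
    and dv1 = -+ c_s drho / (rho gamma^2).  Let P be the matrix of these three
    waves, each normalised to change D by 1.  Then
      dU/dV P = T,    dF/dV P = T Lambda,    T^T dW/dV P diag(d) = 1.
    The first two ([jacU_waves], [jacF_waves]) say that the columns of T are the
    same waves seen in the conserved variables, travelling with the speeds in
    Lambda.  The third says that they are orthogonal for the entropy Hessian
    dW/dU, with squared lengths 1 / d_j.  It is split in two: [waves_jacW]
    computes T^T dW/dV, whose rows are multiples of the familiar left
    eigenvectors of the primitive system and no longer involve v1 except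
    through gamma, and [prim_covectors_waves] pairs them with P.

    Linear algebra does the rest ([symmetrized_eigenbasis]).  The third identity
    makes T, P and dW/dV invertible and gives (dW/dV)^-1 = P diag(d) T^T, hence
    dU/dW = T diag(d) T^T; since each d_j is positive this is R R^T, and
    rescaling the columns of T does not affect diagonalisation.

    The equation of state enters the algebra only through the relation
    h c_s^2 e' = theta (1 + e').  With it d_1 and d_3 become
    rho e' gamma (1 -+ v1 c_s) / (2 (1 + e')), which is positive because
    c_s < 1, and c_s < 1 is precisely the assumed lower bound on h. *)

(** * Gradients of scalar functions of a row vector *)

(** A gradient is kept as a row vector, so that differentiation rules become
    vector arithmetic and a Jacobian is the matrix of the gradients of the
    components. *)
Definition is_grad (R : realType) n (f : 'rV[R]_n.+1 -> R) (V g : 'rV[R]_n.+1) :=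
  is_diff V f (fun u => (u *m g^T) 0 0).

Section Gradient.
Variables (R : realType) (n : nat).
Implicit Types (f g : 'rV[R]_n.+1 -> R) (V a b : 'rV[R]_n.+1).

Lemma is_grad_eq f V a b : is_grad f V a -> a = b -> is_grad f V b.
Proof. by move=> fa <-. Qed.

Lemma is_grad_coord i V : is_grad (fun W : 'rV[R]_n.+1 => W 0 i) V (delta_mx 0 i).
Proof.
have lin : linear (fun W : 'rV[R]_n.+1 => W 0 i : R^o).
  by move=> k u v; rewrite !mxE.
pose L := GRing.isLinear.Build _ _ _ _ _ lin.
pose F : {linear 'rV[R]_n.+1 -> R^o} :=
  HB.pack (fun W : 'rV[R]_n.+1 => W 0 i : R^o) L.
have cF : continuous F by move=> ?; exact: coord_continuous.
have dF : differentiable F V by exact: linear_differentiable.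
apply: DiffDef => //.
have -> : (fun W : 'rV[R]_n.+1 => W 0 i) = F by [].
rewrite diff_lin//; apply/funext => u /=.
by rewrite trmx_delta -colE mxE.
Qed.

Lemma is_gradD f g V a b :
  is_grad f V a -> is_grad g V b -> is_grad (fun W => f W + g W) V (a + b).
Proof.
move=> fa gb; apply: (is_diff_eq (is_diffD fa gb)).
by apply/funext => u; rewrite linearD/= mulmxDr mxE.
Qed.

Lemma is_gradN f V a : is_grad f V a -> is_grad (fun W => - f W) V (- a).
Proof.
move=> fa; apply: (is_diff_eq (is_diffN fa)).
by apply/funext => u; rewrite linearN/= mulmxN mxE.
Qed.

Lemma is_gradM f g V a b : is_grad f V a -> is_grad g V b ->
  is_grad (fun W => f W * g W) V (f V *: b + g V *: a).
Proof.
move=> fa gb; apply: (is_diff_eq (is_diffM fa gb)).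
by apply/funext => u; rewrite [in RHS]linearD !linearZ mulmxDr -!scalemxAr
  [RHS]mxE [X in _ = X + _]mxE [X in _ = _ + X]mxE.
Qed.

Lemma is_grad_comp (phi : R -> R) f V a k :
  is_derive (f V) 1 phi k -> is_grad f V a -> is_grad (phi \o f) V (k *: a).
Proof.
move=> phik fa.
have dphi : is_diff (f V) phi (fun t => t *: k).
  have d : differentiable phi (f V) by apply/derivable1_diffP; exact: ex_derive.
  apply: DiffDef => //.
  rewrite diff1E//; apply/funext => t /=; congr (_ *: _).
  by rewrite derive1E derive_val.
apply: (is_diff_eq (is_diff_comp fa dphi)).
by apply/funext => u /=; rewrite linearZ -scalemxAr [RHS]mxE; exact: mulrC.
Qed.

Lemma is_gradV f V a : f V != 0 ->
  is_grad f V a -> is_grad (fun W => (f W)^-1) V (- (f V) ^- 2 *: a).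
Proof.
move=> f0; apply: (@is_grad_comp GRing.inv).
by apply: (is_derive_eq (is_deriveV f0 (is_derive_id _ _)));
  rewrite /GRing.scale/= mulr1.
Qed.

End Gradient.

(** * Vectors, matrices and Jacobians in dimension three

    Products and Jacobians are put in the explicit form [mat3 (vec3 _ _ _)
    (vec3 _ _ _) (vec3 _ _ _)], so that a matrix identity splits by congruence
    into nine scalar ones. *)

Section Vec3.
Variable R : realType.
Implicit Types (V g : 'rV[R]_3).

Lemma vec3E (a b c : R) :
  vec3 a b c = a *: delta_mx 0 0 + b *: delta_mx 0 1 + c *: delta_mx 0 2.
Proof.
by apply/rowP => -[[|[|[|//]]] ?]; rewrite !mxE/= ?mulr1n; lra.
Qed.

Lemma vec3D (a b c a' b' c' : R) :
  vec3 a b c + vec3 a' b' c' = vec3 (a + a') (b + b') (c + c').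
Proof. by apply/rowP => -[[|[|[|//]]] ?]; rewrite !mxE. Qed.

Lemma vec3N (a b c : R) : - vec3 a b c = vec3 (- a) (- b) (- c).
Proof. by apply/rowP => -[[|[|[|//]]] ?]; rewrite !mxE. Qed.

Lemma vec3Z (k a b c : R) : k *: vec3 a b c = vec3 (k * a) (k * b) (k * c).
Proof. by apply/rowP => -[[|[|[|//]]] ?]; rewrite !mxE. Qed.

Lemma is_diff_vec3 (f1 f2 f3 : 'rV[R]_3 -> R) V g1 g2 g3 :
  is_grad f1 V g1 -> is_grad f2 V g2 -> is_grad f3 V g3 ->
  is_diff V (fun W => vec3 (f1 W) (f2 W) (f3 W))
            (fun u => u *m (mat3 g1 g2 g3)^T).
Proof.
move=> d1 d2 d3.
have dZ (f : 'rV[R]_3 -> R) g (w : 'rV[R]_3) : is_grad f V g ->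
    is_diff V (fun W => f W *: w) (fun u => (u *m g^T) 0 0 *: w).
  by move=> fg; exact: (is_diff_comp fg (is_diff_scalel (f V) w)).
have -> : (fun W => vec3 (f1 W) (f2 W) (f3 W)) =
    (fun W => f1 W *: delta_mx 0 0) + (fun W => f2 W *: delta_mx 0 1) +
    (fun W => f3 W *: delta_mx 0 2).
  by apply/funext => W; rewrite vec3E.
apply: (is_diff_eq (is_diffD (is_diffD (dZ _ _ _ d1) (dZ _ _ _ d2))
  (dZ _ _ _ d3))).
apply/funext => u /=; rewrite -[LHS]vec3E.
by apply/rowP => -[[|[|[|//]]] ?]; rewrite !mxE/=; apply: eq_bigr => j _;
  rewrite !mxE.
Qed.

Lemma Dmx_is_diff (f : 'rV[R]_3 -> 'rV[R]_3) V (A : 'M[R]_3) :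
  is_diff V f (fun u => u *m A^T) -> Dmx f V = A.
Proof.
move=> fA; rewrite /Dmx /jacobian diff_val.
apply/matrixP => i j.
by rewrite [LHS]mxE [LHS]mxE -rowE !mxE.
Qed.

End Vec3.

Lemma mul_mat3 (R : realType) (a b c d e f g h i a' b' c' d' e' f' g' h' i' : R) :
  mat3 (vec3 a b c) (vec3 d e f) (vec3 g h i) *m
  mat3 (vec3 a' b' c') (vec3 d' e' f') (vec3 g' h' i') =
  mat3 (vec3 (a * a' + b * d' + c * g') (a * b' + b * e' + c * h')
             (a * c' + b * f' + c * i'))
       (vec3 (d * a' + e * d' + f * g') (d * b' + e * e' + f * h')
             (d * c' + e * f' + f * i'))
       (vec3 (g * a' + h * d' + i * g') (g * b' + h * e' + i * h')
             (g * c' + h * f' + i * i')).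
Proof.
by apply/matrixP => -[[|[|[|//]]] ?] -[[|[|[|//]]] ?];
  rewrite mxE !big_ord_recl big_ord0 addr0 addrA !mxE.
Qed.

Lemma tr_mat3 (R : realType) (a b c d e f g h i : R) :
  (mat3 (vec3 a b c) (vec3 d e f) (vec3 g h i))^T =
  mat3 (vec3 a d g) (vec3 b e h) (vec3 c f i).
Proof.
by apply/matrixP => -[[|[|[|//]]] ?] -[[|[|[|//]]] ?]; rewrite !mxE.
Qed.

Lemma diag_mat3 (R : realType) (a b c : R) :
  diag_mx (vec3 a b c) = mat3 (vec3 a 0 0) (vec3 0 b 0) (vec3 0 0 c).
Proof.
by apply/matrixP => -[[|[|[|//]]] ?] -[[|[|[|//]]] ?]; rewrite !mxE.
Qed.

Lemma scalar_mat3 (R : realType) (a : R) :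
  a%:M = mat3 (vec3 a 0 0) (vec3 0 a 0) (vec3 0 0 a).
Proof.
by apply/matrixP => -[[|[|[|//]]] ?] -[[|[|[|//]]] ?]; rewrite !mxE.
Qed.

(** * Waves in primitive, conserved and entropy variables *)

Section Waves.
Variables (R : realType) (rho v th h e' g c : R).

(** [jacU], [jacF] and [jacW] are the Jacobians of the conserved, flux and
    entropy variables in V, with [g] for the Lorentz factor and [c] for the sound
    speed.  The relation g^2 (1 - v^2) = 1 has been used to make every entry of
    [jacU] and [jacF] a single power of [g] times an expression free of [g]; their
    products with [prim_waves] then simplify without that relation. *)
Definition jacU : 'M[R]_3 := mat3
  (vec3 g (rho * g ^+ 3 * v) 0)
  (vec3 ((h - th * (1 + e')) * g ^+ 2 * v) (rho * h * g ^+ 4 * (1 + v ^+ 2))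
        ((1 + e') * g ^+ 2 * v))
  (vec3 ((h - th * (1 + e')) * g ^+ 2) (2 * rho * h * g ^+ 4 * v)
        ((e' + v ^+ 2) * g ^+ 2)).

Definition jacF : 'M[R]_3 := mat3
  (vec3 (g * v) (rho * g ^+ 3) 0)
  (vec3 ((h - th * (1 + e')) * g ^+ 2 * v ^+ 2) (2 * rho * h * g ^+ 4 * v)
        ((1 + e' * v ^+ 2) * g ^+ 2))
  (vec3 ((h - th * (1 + e')) * g ^+ 2 * v) (rho * h * g ^+ 4 * (1 + v ^+ 2))
        ((1 + e') * g ^+ 2 * v)).

Definition jacW : 'M[R]_3 := mat3
  (vec3 (h / (th * rho)) 0 ((th - h) / (th ^+ 2 * rho)))
  (vec3 (g * v / (th * rho)) (g ^+ 3 / th) (- (g * v) / (th ^+ 2 * rho)))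
  (vec3 (- g / (th * rho)) (- (g ^+ 3 * v) / th) (g / (th ^+ 2 * rho))).

(** The eigenvector matrix before its columns are scaled by the square roots of
    [weights]; the first row is constant because every wave changes the density
    D by 1. *)
Definition waves : 'M[R]_3 := mat3
  (vec3 1 1 1)
  (vec3 ((v - c) * h * g) ((h - th * (1 + e')) * g * v) ((v + c) * h * g))
  (vec3 ((1 - v * c) * h * g) ((h - th * (1 + e')) * g) ((1 + v * c) * h * g)).

(** Columns: the acoustic wave running to the left, the contact wave and the
    acoustic wave running to the right, as variations of (rho, v1, p).  Acoustic
    waves satisfy dp = h c^2 drho (constant entropy) and
    dv1 = -+ c drho / (rho g^2). *)
Definition prim_waves : 'M[R]_3 := mat3
  (vec3 (g * (1 - v * c))^-1 g^-1 (g * (1 + v * c))^-1)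
  (vec3 (- c / (rho * g ^+ 3 * (1 - v * c))) 0 (c / (rho * g ^+ 3 * (1 + v * c))))
  (vec3 (h * c ^+ 2 / (g * (1 - v * c))) 0 (h * c ^+ 2 / (g * (1 + v * c)))).

Definition speeds : 'rV[R]_3 :=
  vec3 ((v - c) / (1 - v * c)) v ((v + c) / (1 + v * c)).

Definition weights : 'rV[R]_3 := vec3
  ((rho * e' / (2 * (1 + e')) - rho * th * v / (2 * c * h)) * g)
  (rho * g / (1 + e'))
  ((rho * e' / (2 * (1 + e')) + rho * th * v / (2 * c * h)) * g).

(** The linear forms dp -+ rho h c g^2 dv1 (Riemann invariants along the acoustic
    characteristics) and theta (1 + e') drho - e' dp (a multiple of the
    entropy differential), up to scaling. *)
Definition prim_covectors : 'M[R]_3 := mat3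
  (vec3 0 (- (h * c * g ^+ 2 / th)) (th * rho)^-1)
  (vec3 ((1 + e') / rho) 0 (- (e' / (th * rho))))
  (vec3 0 (h * c * g ^+ 2 / th) (th * rho)^-1).

Hypotheses (rho0 : rho != 0) (th0 : th != 0) (h0 : h != 0) (e'0 : e' != 0)
  (e'1 : 1 + e' != 0) (g0 : g != 0) (c0 : c != 0)
  (left0 : 1 - v * c != 0) (right0 : 1 + v * c != 0).
Hypothesis gsqr : g ^+ 2 * (1 - v ^+ 2) = 1.
Hypothesis csqr : h * c ^+ 2 * e' = th * (1 + e').

(** Once theta (1 + e') is replaced by h c^2 e', both sides are rational functions
    of independent variables; the same holds for [jacF_waves]. *)
Lemma jacU_waves : jacU *m prim_waves = waves.
Proof.
rewrite mul_mat3 /waves -csqr; congr (mat3 (vec3 _ _ _) (vec3 _ _ _) (vec3 _ _ _)).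
all: field; rewrite ?g0 ?rho0 ?left0 ?right0 //.
Qed.

Lemma jacF_waves : jacF *m prim_waves = waves *m diag_mx speeds.
Proof.
rewrite diag_mat3 !mul_mat3 -csqr.
congr (mat3 (vec3 _ _ _) (vec3 _ _ _) (vec3 _ _ _)).
all: field; rewrite ?g0 ?rho0 ?left0 ?right0 //.
Qed.

(** Each entry is an affine function of g^2 (1 - v^2) once the terms in [v] are
    collected, which is what the intermediate expressions display. *)
Lemma waves_jacW : waves^T *m jacW = prim_covectors.
Proof.
rewrite tr_mat3 mul_mat3; congr (mat3 (vec3 _ _ _) (vec3 _ _ _) (vec3 _ _ _)).
- transitivity (h / (th * rho) * (1 - g ^+ 2 * (1 - v ^+ 2))).
    by field; rewrite rho0 th0.
  by rewrite gsqr; ring.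
- transitivity (- (h * c * (g ^+ 2 * (g ^+ 2 * (1 - v ^+ 2))) / th)).
    by field.
  by rewrite gsqr mulr1.
- transitivity ((th * rho)^-1 - h / (th ^+ 2 * rho) * (1 - g ^+ 2 * (1 - v ^+ 2))).
    by field; rewrite rho0 th0.
  by rewrite gsqr; ring.
- transitivity (h / (th * rho)
      - (h - th * (1 + e')) / (th * rho) * (g ^+ 2 * (1 - v ^+ 2))).
    by field; rewrite rho0 th0.
  by rewrite gsqr; field; rewrite rho0 th0.
- by field.
- transitivity ((th - h) / (th ^+ 2 * rho)
      + (h - th * (1 + e')) / (th ^+ 2 * rho) * (g ^+ 2 * (1 - v ^+ 2))).
    by field; rewrite rho0 th0.
  by rewrite gsqr; field; rewrite rho0 th0.
- transitivity (h / (th * rho) * (1 - g ^+ 2 * (1 - v ^+ 2))).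
    by field; rewrite rho0 th0.
  by rewrite gsqr; ring.
- transitivity (h * c * (g ^+ 2 * (g ^+ 2 * (1 - v ^+ 2))) / th).
    by field.
  by rewrite gsqr mulr1.
- transitivity ((th * rho)^-1 - h / (th ^+ 2 * rho) * (1 - g ^+ 2 * (1 - v ^+ 2))).
    by field; rewrite rho0 th0.
  by rewrite gsqr; ring.
Qed.

(** The forms of one family vanish on the waves of the others, and the diagonal
    pairings are the inverses of [weights]; solving the sound speed relation
    for theta makes all of this a rational identity. *)
Lemma prim_covectors_waves :
  prim_covectors *m prim_waves *m diag_mx weights = 1%:M.
Proof.
have thE : th = h * c ^+ 2 * e' / (1 + e') by rewrite csqr mulfK.
rewrite diag_mat3 !mul_mat3 scalar_mat3 thE.
congr (mat3 (vec3 _ _ _) (vec3 _ _ _) (vec3 _ _ _)).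
all: field; rewrite ?g0 ?rho0 ?h0 ?c0 ?e'0 ?e'1 ?left0 ?right0 //.
Qed.
End Waves.

(** * Jacobians with respect to the primitive variables *)

Section Lorentz.
Variables (R : realType) (v : R).
Hypothesis v_lt1 : `|v| < 1.

Lemma sub1_sqr_gt0 : 0 < 1 - v ^+ 2.
Proof. by rewrite subr_gt0 -real_normK ?num_real// expr_lt1. Qed.

Lemma lorentz_gt0 : 0 < lorentz v.
Proof. by rewrite invr_gt0 sqrtr_gt0 sub1_sqr_gt0. Qed.

Lemma lorentz_sqr : lorentz v ^+ 2 * (1 - v ^+ 2) = 1.
Proof.
rewrite exprVn sqr_sqrtr ?mulVf//; first exact: lt0r_neq0 sub1_sqr_gt0.
exact: ltW sub1_sqr_gt0.
Qed.

Lemma is_derive_lorentz : is_derive v 1 (@lorentz R) (v * lorentz v ^+ 3).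
Proof.
have d1 : is_derive v 1 (fun w : R => 1 - w ^+ 2) (- (2 * v)).
  apply: (@is_derive_eq _ _ _ (fun w : R => 1 - w ^+ 2)).
  by rewrite /GRing.scale/=; ring.
have dsqrt := is_derive1_sqrt sub1_sqr_gt0.
have s0 : Num.sqrt (1 - v ^+ 2) != 0 by rewrite sqrtr_eq0 -ltNge sub1_sqr_gt0.
have d := @is_deriveV _ (fun w => Num.sqrt (1 - w ^+ 2)) v _ _ s0
  (@is_derive1_comp _ Num.sqrt (fun w => 1 - w ^+ 2) v _ _ dsqrt d1).
apply: (is_derive_eq d).
by rewrite /lorentz /GRing.scale/=; field.
Qed.
End Lorentz.

Section Jacobians.
Variables (R : realType) (e : R -> R) (V : 'rV[R]_3).
Hypotheses (e_derivable : derivable e (theta_of V) 1)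
  (rho_gt0 : 0 < rho_of V) (v_lt1 : `|vel V| < 1) (p_gt0 : 0 < pres V).

Let rho := rho_of V.
Let v := vel V.
Let th := theta_of V.
Let h := enthalpy e th.
Let e' := e^`()%classic th.
Let g := lorentz v.

Let rho0 : rho != 0. Proof. exact: lt0r_neq0. Qed.
Let th0 : th != 0. Proof. by apply: lt0r_neq0; exact: divr_gt0. Qed.
(* Raising the degree in [g] by two, at the cost of a factor 1 - v^2, makes the
   terms of an entry homogeneous, after which it is a ring identity. *)
Let gsqr n : g ^+ n = g ^+ n.+2 * (1 - v ^+ 2).
Proof. by rewrite -addn2 exprD -mulrA lorentz_sqr ?mulr1. Qed.

Ltac grad_entries :=
  rewrite /= ?(vec3Z, vec3N, vec3D) -?/rho -?/v -?/th -?/h -?/g;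
  congr (vec3 _ _ _).

Let is_grad_rho : is_grad (@rho_of R) V (vec3 1 0 0).
Proof.
by apply: (is_grad_eq (is_grad_coord 0 V)); rewrite vec3E !scale0r !addr0 scale1r.
Qed.

Let is_grad_vel : is_grad (@vel R) V (vec3 0 1 0).
Proof.
apply: (is_grad_eq (is_grad_coord 1 V)).
by rewrite vec3E !scale0r addr0 add0r scale1r.
Qed.

Let is_grad_pres : is_grad (@pres R) V (vec3 0 0 1).
Proof.
by apply: (is_grad_eq (is_grad_coord 2 V)); rewrite vec3E !scale0r !add0r scale1r.
Qed.

Let is_grad_theta : is_grad (@theta_of R) V (vec3 (- th / rho) 0 rho^-1).
Proof.
apply: (is_grad_eq (is_gradM is_grad_pres (is_gradV rho0 is_grad_rho))).
by grad_entries; rewrite /th /theta_of -/rho; field.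
Qed.

Let is_grad_enthalpy : is_grad (fun W => enthalpy e (theta_of W)) V
  ((1 + e') *: vec3 (- th / rho) 0 rho^-1).
Proof.
apply: (is_grad_comp _ is_grad_theta).
have de : is_derive (theta_of V) 1 e e'.
  by apply: DeriveDef => //; rewrite /e' derive1E.
have d := is_deriveD (is_deriveD (is_derive_cst (1 : R) (theta_of V) 1) de)
  (is_derive_id (theta_of V) 1).
by apply: (is_derive_eq d); rewrite add0r addrC.
Qed.

Let is_grad_lorentz :
  is_grad (fun W => lorentz (vel W)) V (vec3 0 (v * g ^+ 3) 0).
Proof.
apply: (is_grad_eq (is_grad_comp (is_derive_lorentz v_lt1) is_grad_vel)).
by grad_entries; ring.
Qed.

Let is_grad_density : is_grad (fun W => rho_of W * lorentz (vel W)) V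
  (vec3 g (rho * g ^+ 3 * v) 0).
Proof.
apply: (is_grad_eq (is_gradM is_grad_rho is_grad_lorentz)).
by grad_entries; ring.
Qed.

Let is_grad_energy_plus_pres :
  is_grad (fun W => rho_of W * enthalpy e (theta_of W) * lorentz (vel W) ^+ 2) V
  (vec3 ((h - th * (1 + e')) * g ^+ 2) (2 * rho * h * g ^+ 4 * v)
        ((1 + e') * g ^+ 2)).
Proof.
apply: (is_grad_eq (is_gradM (is_gradM is_grad_rho is_grad_enthalpy)
  (is_gradM is_grad_lorentz is_grad_lorentz))).
by grad_entries; field.
Qed.

Let is_grad_momentum :
  is_grad (fun W => rho_of W * enthalpy e (theta_of W) * lorentz (vel W) ^+ 2
                    * vel W) V
    (vec3 ((h - th * (1 + e')) * g ^+ 2 * v) (rho * h * g ^+ 4 * (1 + v ^+ 2))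
          ((1 + e') * g ^+ 2 * v)).
Proof.
apply: (is_grad_eq (is_gradM is_grad_energy_plus_pres is_grad_vel)).
by grad_entries; [ring | rewrite (gsqr 2); ring | ring].
Qed.

Lemma is_diff_consU : is_diff V (consU e)
  (fun u => u *m (jacU rho v th h e' g)^T).
Proof.
apply: (is_diff_vec3 is_grad_density is_grad_momentum).
apply: (is_grad_eq (is_gradD is_grad_energy_plus_pres (is_gradN is_grad_pres))).
grad_entries; [ring | ring |].
by have := gsqr 0; rewrite expr0 => g1; lra.
Qed.

Lemma fluxF1E W : fluxF1 e W =
  vec3 (rho_of W * lorentz (vel W) * vel W)
    (vel W * (rho_of W * enthalpy e (theta_of W) * lorentz (vel W) ^+ 2 * vel W)
     + pres W)
    (rho_of W * enthalpy e (theta_of W) * lorentz (vel W) ^+ 2 * vel W).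
Proof. by rewrite /fluxF1 /consU !mxE. Qed.

Lemma is_diff_fluxF1 : is_diff V (fluxF1 e)
  (fun u => u *m (jacF rho v th h e' g)^T).
Proof.
rewrite (funext fluxF1E); apply: is_diff_vec3 is_grad_momentum.
  apply: (is_grad_eq (is_gradM is_grad_density is_grad_vel)).
  grad_entries; [ring | | ring].
  by have := gsqr 1; rewrite expr1 => {1}->; ring.
apply: (is_grad_eq (is_gradD (is_gradM is_grad_vel is_grad_momentum) is_grad_pres)).
grad_entries; [ring | by rewrite (gsqr 2); ring |].
by have := gsqr 0; rewrite expr0 => g1; lra.
Qed.

Lemma is_diff_entropyW (s : R -> R) : is_derive th 1 s (e' / th) ->
  is_diff V (entropyW e s) (fun u => u *m (jacW rho v th h g)^T).
Proof.
move=> ds.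
have entropyWE W : entropyW e s W =
    vec3 ((theta_of W)^-1 * (enthalpy e (theta_of W) - theta_of W * entropyS s W))
      ((theta_of W)^-1 * (lorentz (vel W) * vel W))
      ((theta_of W)^-1 * - lorentz (vel W)).
  by rewrite -vec3Z.
have gradI := is_gradV th0 is_grad_theta.
have gradS : is_grad (entropyS s) V
    (vec3 (- rho^-1 - e' / rho) 0 (e' / (th * rho))).
  apply: (is_grad_eq (is_gradD
    (is_gradN (is_grad_comp (is_derive1_ln rho_gt0) is_grad_rho))
    (is_grad_comp ds is_grad_theta))).
  by grad_entries; field; rewrite ?th0 rho0.
rewrite (funext entropyWE); apply: is_diff_vec3.
- apply: (is_grad_eq (is_gradM gradI (is_gradD is_grad_enthalpy
    (is_gradN (is_gradM is_grad_theta gradS))))).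
  by grad_entries; field; rewrite ?th0 ?rho0.
- apply: (is_grad_eq (is_gradM gradI (is_gradM is_grad_lorentz is_grad_vel))).
  grad_entries; [by field; rewrite th0 rho0 | | by field; rewrite th0 rho0].
  transitivity ((g * 1 + v ^+ 2 * g ^+ 3) / th); first by field.
  by have := gsqr 1; rewrite expr1 => {1}->; field.
- apply: (is_grad_eq (is_gradM gradI (is_gradN is_grad_lorentz))).
  by grad_entries; field; rewrite ?th0 ?rho0.
Qed.

End Jacobians.

(** * Sound speed and positivity of the weights *)

Section SoundSpeed.
Variables (R : realType) (e : R -> R) (th : R).
Hypotheses (th_gt0 : 0 < th) (e'_gt0 : 0 < e^`()%classic th)
  (h_gt : th * (1 + e^`()%classic th) / e^`()%classic th < enthalpy e th).

Lemma enthalpy_gt0 : 0 < enthalpy e th.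
Proof.
apply: le_lt_trans h_gt; apply: divr_ge0; last exact: ltW.
by apply: mulr_ge0; [exact: ltW | exact/ltW/addr_gt0].
Qed.

Let he'_gt0 : 0 < enthalpy e th * e^`()%classic th.
Proof. by apply: mulr_gt0 => //; exact: enthalpy_gt0. Qed.

Let ratio_gt0 :
  0 < th * (1 + e^`()%classic th) / (enthalpy e th * e^`()%classic th).
Proof. by apply: divr_gt0 => //; apply: mulr_gt0 => //; exact: addr_gt0. Qed.

Lemma sound_speed_gt0 : 0 < sound_speed e th.
Proof. by rewrite sqrtr_gt0. Qed.

Lemma sound_speed_lt1 : sound_speed e th < 1.
Proof.
rewrite -sqrtr1 ltr_sqrt// ltr_pdivrMr// mul1r.
by have := h_gt; rewrite ltr_pdivrMr.
Qed.

Lemma sound_speed_sqr :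
  enthalpy e th * sound_speed e th ^+ 2 * e^`()%classic th =
  th * (1 + e^`()%classic th).
Proof.
by rewrite sqr_sqrtr 1?ltW// mulrAC mulrC divfK// lt0r_neq0.
Qed.

End SoundSpeed.

(** By the sound speed relation theta / (c h) = c e' / (1 + e'), so the two acoustic
    weights are positive multiples of 1 -+ v c. *)
Lemma weights_gt0 (R : realType) (rho v th h e' g c : R) (j : 'I_3) :
  0 < rho -> 0 < h -> 0 < e' -> 0 < g -> 0 < c -> `|v * c| < 1 ->
  h * c ^+ 2 * e' = th * (1 + e') -> 0 < weights rho v th h e' g c 0 j.
Proof.
move=> rho_gt0 h_gt0 e'_gt0 g_gt0 c_gt0; rewrite ltr_norml => /andP[lo hi] csqr.
have e'1_gt0 : 0 < 1 + e' by exact: addr_gt0.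
have thE : th = h * c ^+ 2 * e' / (1 + e') by rewrite csqr mulfK ?lt0r_neq0.
have acoustic (x : R) : 0 < 1 + x -> 0 < rho * e' * g / (2 * (1 + e')) * (1 + x).
  by move=> x1; rewrite !(mulr_gt0, invr_gt0).
have weightsE : weights rho v th h e' g c = vec3
    (rho * e' * g / (2 * (1 + e')) * (1 + - (v * c)))
    (rho * g / (1 + e'))
    (rho * e' * g / (2 * (1 + e')) * (1 + v * c)).
  rewrite /weights thE.
  by congr (vec3 _ _ _); field; rewrite !lt0r_neq0.
rewrite weightsE mxE; case: j => -[|[|[|//]]] ? /=.
- by apply: acoustic; lra.
- by rewrite divr_gt0 ?mulr_gt0.
- by apply: acoustic; lra.
Qed.

(** * The symmetrised eigenvector matrix *)

(** The columns of T = U P are eigenvectors of F U^-1; the orthogonality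
    hypothesis says that they also diagonalise the bilinear form
    W U^-1, with diagonal entries 1 / d_j.  Scaling them by the square roots of
    the d_j makes them orthonormal, that is Q Q^T = U W^-1, without changing
    their directions. *)
Lemma symmetrized_eigenbasis (R : realType) n (U F W T P : 'M[R]_n)
    (lam d : 'rV[R]_n) :
  U *m P = T -> F *m P = T *m diag_mx lam ->
  T^T *m W *m P *m diag_mx d = 1%:M -> (forall j, 0 < d 0 j) ->
  let Q := T *m diag_mx (map_mx Num.sqrt d) in
  [/\ [/\ U \in unitmx, W \in unitmx & Q \in unitmx],
      F *m invmx U = Q *m diag_mx lam *m invmx Q &
      U *m invmx W = Q *m Q^T].
Proof.
move=> UP FP ortho d_gt0 Q.
set S := diag_mx (map_mx Num.sqrt d).
have SS : S *m S = diag_mx d.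
  rewrite mulmx_diag; congr diag_mx; apply/rowP => j.
  by rewrite !mxE -expr2 sqr_sqrtr// ltW.
(* A one-sided inverse of a square matrix is two-sided, so T^T can be moved from
   the left end of the orthogonality relation to the right end. *)
have dual : W *m (P *m diag_mx d *m T^T) = 1%:M.
  by rewrite !mulmxA; apply: mulmx1C; rewrite !mulmxA.
have [W_unit PDT_unit] := mulmx1_unit dual.
have : T \in unitmx /\ S \in unitmx.
  by move: PDT_unit; rewrite -SS !unitmx_mul unitmx_tr => /andP[/and3P[_ -> _] ->].
move=> [T_unit S_unit].
have Q_unit : Q \in unitmx by rewrite unitmx_mul T_unit.
have U_unit : U \in unitmx by move: T_unit; rewrite -UP unitmx_mul => /andP[].
split=> //.
- have -> : Q *m diag_mx lam = F *m invmx U *m Q.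
    have FUT : F *m invmx U *m T = T *m diag_mx lam.
      by rewrite -{1}UP -mulmxA (mulKmx U_unit).
    by rewrite /Q [RHS]mulmxA FUT -!mulmxA; congr (_ *m _); exact: diag_mxC.
  by rewrite mulmxK.
- have -> : invmx W = P *m diag_mx d *m T^T.
    by rewrite -[RHS](mulKmx W_unit) dual mulmx1.
  rewrite /Q trmx_mul tr_diag_mx -/S !mulmxA UP -SS.
  by rewrite !mulmxA.
Qed.

Theorem theorem6 (R : realType) (e s : R -> R)
  (e_derivable : forall x : R, 0 < x -> derivable e x 1)
  (e'_continuous : forall x : R, 0 < x -> {for x, continuous (e^`()%classic)})
  (s_antiderivative : forall x : R, 0 < x ->
     is_derive x (1 : R) s (e^`()%classic x / x))
  (e'_gt0 : forall x : R, 0 < x -> 0 < e^`()%classic x)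
  (h_gt : forall x : R, 0 < x ->
     x * (1 + e^`()%classic x) / e^`()%classic x < enthalpy e x)
  (rho v1 p : R) (rho_gt0 : 0 < rho) (v1_lt1 : `|v1| < 1) (p_gt0 : 0 < p) :
  let V := vec3 rho v1 p in
  [/\ [/\ differentiable (fluxF1 e) V, differentiable (consU e) V &
          differentiable (entropyW e s) V],
      [/\ Dmx (consU e) V \in unitmx, Dmx (entropyW e s) V \in unitmx &
          Rmx e V \in unitmx],
      dF1dU e V = Rmx e V *m Lambdamx e V *m invmx (Rmx e V) &
      dUdW e s V = Rmx e V *m (Rmx e V)^T].
Proof.
move=> V.
have rhoV : rho_of V = rho by rewrite /rho_of mxE.
have velV : vel V = v1 by rewrite /vel mxE.
have presV : pres V = p by rewrite /pres mxE.
set th := theta_of V.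
have th_gt0 : 0 < th by rewrite /th /theta_of rhoV presV divr_gt0.
have e'_gt := e'_gt0 _ th_gt0.
have hlow := h_gt _ th_gt0.
have h_gt0 := enthalpy_gt0 th_gt0 e'_gt hlow.
have c_gt0 := sound_speed_gt0 th_gt0 e'_gt hlow.
have c_lt1 := sound_speed_lt1 th_gt0 e'_gt hlow.
have csqr := sound_speed_sqr th_gt0 e'_gt hlow.
have g_gt0 := lorentz_gt0 v1_lt1.
have gsqr := lorentz_sqr v1_lt1.
have rhoV_gt0 : 0 < rho_of V by rewrite rhoV.
have velV_lt1 : `|vel V| < 1 by rewrite velV.
have presV_gt0 : 0 < pres V by rewrite presV.
have e_th := e_derivable _ th_gt0.
have diffU := is_diff_consU e_th rhoV_gt0 velV_lt1.
have diffF := is_diff_fluxF1 e_th rhoV_gt0 velV_lt1.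
have diffW := is_diff_entropyW e_th rhoV_gt0 velV_lt1 presV_gt0
  (s_antiderivative _ th_gt0).
have v_c_lt1 : `|v1 * sound_speed e th| < 1.
  rewrite normrM (gtr0_norm c_gt0).
  by apply: le_lt_trans c_lt1; rewrite ler_piMl ?ltW.
have h0 := lt0r_neq0 h_gt0.
have e'0 := lt0r_neq0 e'_gt.
have c0 := lt0r_neq0 c_gt0.
have g0 := lt0r_neq0 g_gt0.
have rho0 := lt0r_neq0 rho_gt0.
have th0 := lt0r_neq0 th_gt0.
have e'1 : 1 + e^`()%classic th != 0 by rewrite lt0r_neq0 ?addr_gt0.
have [left0 right0] :
    1 - v1 * sound_speed e th != 0 /\ 1 + v1 * sound_speed e th != 0.
  by move: v_c_lt1; rewrite ltr_norml => /andP[? ?]; split; apply: lt0r_neq0; lra.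
set T := waves v1 th (enthalpy e th) (e^`()%classic th) (lorentz v1)
  (sound_speed e th).
set d := weights rho v1 th (enthalpy e th) (e^`()%classic th) (lorentz v1)
  (sound_speed e th).
have RE : Rmx e V = T *m diag_mx (map_mx Num.sqrt d).
  rewrite /Rmx rhoV velV; congr (_ *m diag_mx _).
  by apply/rowP => -[[|[|[|//]]] ?]; rewrite !mxE.
have LE : Lambdamx e V = diag_mx (speeds v1 (sound_speed e th)).
  by rewrite /Lambdamx velV.
have ortho : T^T *m jacW rho v1 th (enthalpy e th) (lorentz v1)
    *m prim_waves rho v1 (enthalpy e th) (lorentz v1) (sound_speed e th)
    *m diag_mx d = 1%:M.
  by rewrite waves_jacW// prim_covectors_waves.
have [units Feq Ueq] := symmetrized_eigenbasis
  (jacU_waves (v := v1) rho0 g0 left0 right0 csqr)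
  (jacF_waves rho0 g0 left0 right0 csqr) ortho
  (fun j => weights_gt0 j rho_gt0 h_gt0 e'_gt g_gt0 c_gt0 v_c_lt1 csqr).
rewrite /dF1dU /dUdW (Dmx_is_diff diffU) (Dmx_is_diff diffF) (Dmx_is_diff diffW).
by rewrite RE LE rhoV velV; split.
Qed.
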